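(* There exists a $3$-net $(\mathcal{A}_1,\mathcal{A}_2,\mathcal{A}_3,\mathcal{X})$ of degree $5$ in the complex projective plane $\mathbb{P}^2(\mathbb{C})$ which does not realize a group. More precisely, consider the Latin square $$M = \left[\begin{array}{ccccc} 1&2&3&4&5\\ 2&1&4&5&3\\ 3&5&1&2&4\\ 4&3&5&1&2\\ 5&4&2&3&1\end{array}\right].$$ Then $M$ is not isotopic to the multiplication table of a group, and there exist a $3$-net $(\mathcal{A}_1,\mathcal{A}_2,\mathcal{A}_3,\mathcal{X})$ of degree $5$ in $\mathbb{P}^2(\mathbb{C})$ and labelings $\mathcal{A}_i=\{l_{i1},\ldots,l_{i5}\}$ ($i=1,2,3$) such that for all $i,j,n\in\{1,\ldots,5\}$ one has $M_{ij}=n$ if and only if the lines $l_{1i}$, $l_{2j}$, $l_{3n}$ are concurrent.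
   Context: A $3$-net in a projective plane $P$ is a tuple $(\mathcal{A}_1,\mathcal{A}_2,\mathcal{A}_3,\mathcal{X})$, where each $\mathcal{A}_i$ is a nonempty finite set of lines of $P$ and $\mathcal{X}$ is a finite set of points of $P$, such that: (1) the $\mathcal{A}_i$ are pairwise disjoint; (2) if $i\neq j$, the intersection point of any line in $\mathcal{A}_i$ with any line in $\mathcal{A}_j$ belongs to $\mathcal{X}$; (3) through every point of $\mathcal{X}$ there passes exactly one line of each $\mathcal{A}_i$. In a $3$-net all $\mathcal{A}_i$ have the same cardinality $d$, called the degree. A Latin square of order $d$ is a $d\times d$ matrix with entries in $\{1,\ldots,d\}$ in which each symbol occurs exactly once in each row and each column. Two Latin squares of order $d$ are isotopic if one is obtained from the other by permuting rows, permuting columns and permuting symbols. A Latin square is isotopic to the multiplication table of a group if it is isotopic to the table $(g_ig_j)_{i,j}$ of some group $\{g_1,\ldots,g_d\}$, with group elements identified with the symbols $1,\ldots,d$. Given labelings of the lines of a $3$-net of degree $d$, the associated Latin square has $(i,j)$ entry $n$ exactly when $l_{1i},l_{2j},l_{3n}$ are concurrent; changing the labelings changes it to an isotopic one. The net is said to realize a group if this Latin square is isotopic to the multiplication table of a group. *)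

(* Defs.v *)
From HB Require Import structures.
From mathcomp Require Export all_boot all_fingroup all_algebra finmap reals.
From mathcomp.real_closed Require Export complex.

Set Implicit Arguments.
Unset Strict Implicit.
Unset Printing Implicit Defensive.

Import GRing.Theory.

(* The points (resp. lines) of the projective plane over F are the
   1-dimensional (resp. 2-dimensional) linear subspaces of F^3. *)
Section ProjectivePlane.
Variable F : fieldType.

Record point := Point {
  point_vs :> {vspace 'rV[F]_3};
  point_dim : \dim point_vs == 1%N }.

Record line := Line {
  line_vs :> {vspace 'rV[F]_3};
  line_dim : \dim line_vs == 2 }.

HB.instance Definition _ := [isSub for point_vs].
HB.instance Definition _ := [Choice of point by <:].
HB.instance Definition _ := [isSub for line_vs].
HB.instance Definition _ := [Choice of line by <:].

Definition on (p : point) (l : line) : bool := (p <= l)%VS.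

Definition concurrent (l1 l2 l3 : line) : Prop :=
  exists p : point, [/\ on p l1, on p l2 & on p l3].

Lemma line_meet (l m : line) :
  l != m -> exists! p : point, on p l /\ on p m.
Proof.
move=> lm; have /eqP dl := line_dim l; have /eqP dm := line_dim m.
have dI : \dim (l :&: m) == 1%N.
  have lt2 : (\dim (l :&: m) < 2)%N.
    rewrite ltnNge; apply/negP => ge2.
    have /eqP El : (l :&: m)%VS == l by rewrite eqEdim capvSl dl.
    have /eqP Em : (l :&: m)%VS == m by rewrite eqEdim capvSr dm.
    by move/eqP: lm; apply; apply: val_inj; rewrite /= -El.
  have := dimv_sum_cap l m; rewrite dl dm.
  have : (\dim (l + m) <= 3)%N by rewrite (leq_trans (dimvS (subvf _))) // dimvf.
  by case: (\dim (l + m)%VS) => [|[|[|[|]]]]; case: (\dim _) lt2 => [|[|]].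
exists (Point dI); split=> [|q [ql qm]]; first by rewrite /on /= capvSl capvSr.
apply/val_inj/eqP; rewrite eq_sym eqEdim /= subv_cap.
by rewrite (eqP dI) (eqP (point_dim q)) leqnn andbT; apply/andP.
Qed.

End ProjectivePlane.

Section Net.
Variable F : fieldType.
Local Open Scope fset_scope.

(* By [line_meet], the point p in the third clause is the unique intersection
   point of l and m, which are distinct by the second clause. *)
Definition is_net3 (A : 'I_3 -> {fset line F}) (X : {fset point F}) : Prop :=
  [/\ forall i, A i != fset0,
      forall i j : 'I_3, i != j -> [disjoint A i & A j],
      forall i j : 'I_3, i != j -> forall l m : line F, l \in A i -> m \in A j ->
        forall p : point F, on p l -> on p m -> p \in X
    & forall p : point F, p \in X -> forall i, exists! l : line F,
        l \in A i /\ on p l].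

Definition has_degree (A : 'I_3 -> {fset line F}) (d : nat) : Prop :=
  forall i, #|` A i| = d.

Definition is_labeling d (A : 'I_3 -> {fset line F})
    (l : 'I_3 -> 'I_d -> line F) : Prop :=
  forall i, injective (l i) /\ A i = [fset l i k | k in 'I_d].

End Net.

(* The symbols 1, ..., d are encoded as the elements 0, ..., d - 1 of 'I_d. *)
Definition latin_square d (L : 'M['I_d]_d) : Prop :=
  (forall i n, exists! j, L i j = n) /\ (forall j n, exists! i, L i j = n).

Definition isotopic d (L L' : 'M['I_d]_d) : Prop :=
  exists r c s : 'S_d, forall i j, L' (r i) (c j) = s (L i j).

(* T is the multiplication table of the group gT = {g 0, ..., g (d - 1)}. *)
Definition mult_table d (gT : finGroupType) (g : 'I_d -> gT) (T : 'M['I_d]_d) : Prop :=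
  bijective g /\ forall i j, g (T i j) = (g i * g j)%g.

Definition isotopic_to_group d (L : 'M['I_d]_d) : Prop :=
  exists (gT : finGroupType) (g : 'I_d -> gT) (T : 'M['I_d]_d),
    mult_table g T /\ isotopic L T.

Section Realization.
Variable F : fieldType.

Definition associated_square d (l : 'I_3 -> 'I_d -> line F)
    (L : 'M['I_d]_d) : Prop :=
  forall i j n, L i j = n <->
    concurrent (l (inord 0) i) (l (inord 1) j) (l (inord 2) n).

(* Changing the labeling replaces the associated square by an isotopic one, so
   quantifying existentially over labelings is immaterial. *)
Definition realizes_group (A : 'I_3 -> {fset line F}) : Prop :=
  exists d (l : 'I_3 -> 'I_d -> line F) (L : 'M['I_d]_d),
    [/\ is_labeling A l, associated_square l L & isotopic_to_group L].

End Realization.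

(* The entries 1, ..., 5 are shifted by one to land in 'I_5. *)
Definition M : 'M['I_5]_5 := \matrix_(i < 5, j < 5)
  inord (nth 0%N (nth [::]
    [:: [:: 1; 2; 3; 4; 5];
        [:: 2; 1; 4; 5; 3];
        [:: 3; 5; 1; 2; 4];
        [:: 4; 3; 5; 1; 2];
        [:: 5; 4; 2; 3; 1] ] i) j).-1.

(* Main.v *)
Require Import Defs.
From mathcomp Require Import ring.

(** M is realized by fifteen lines with integer coefficients. Three lines are
    concurrent exactly when the determinant of their covectors vanishes, so
    the realization amounts to evaluating 125 integer determinants. The
    concurrences alone force everything else: as the square is Latin, lines
    of one class are distinct, lines of different classes are distinct (any
    two lines meet, so a coincidence would give a repeated or ambiguous
    symbol), and the intersection points of the first two classes make up the
    point set.

    In a group table u_i v_j = w_(M i j), an equality M i j = M i' j' says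
    u_i^-1 u_i' = v_j v_j'^-1. For the first two rows of M this forces the
    square and the cube of u_1^-1 u_2 to be trivial. The argument uses only an
    array of group elements indexed like M, so it also applies to any
    relabelling of the net. *)

Set Implicit Arguments.
Unset Strict Implicit.
Unset Printing Implicit Defensive.

Import GRing.Theory Num.Theory.

(** * The square [M]: Latin, and not a group table *)

Lemma M_entry (i j : 'I_5) :
  nat_of_ord (M i j) = (nth 0%N (nth [::]
    [:: [:: 1; 2; 3; 4; 5];
        [:: 2; 1; 4; 5; 3];
        [:: 3; 5; 1; 2; 4];
        [:: 4; 3; 5; 1; 2];
        [:: 5; 4; 2; 3; 1] ] i) j).-1.
Proof.
(* [inordK] asks that every shifted entry be below 5, which is checked entry by entry. *)
rewrite mxE inordK //.
by case: i => [[|[|[|[|[|]]]]] // ?]; case: j => [[|[|[|[|[|]]]]] // ?].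
Qed.

Lemma latin_square_of_inj d (L : 'M['I_d]_d) :
  (forall i, injective (L i)) -> (forall j, injective (L^~ j)) -> latin_square L.
Proof.
move=> injr injc; split=> [i n|j n].
  have [f fK Kf] := injF_bij (injr i); exists (f n).
  by split=> [|j <-]; [exact: Kf | exact: fK].
have [f fK Kf] := injF_bij (injc j); exists (f n).
by split=> [|i <-]; [exact: Kf | exact: fK].
Qed.

Lemma M_latin : latin_square M.
Proof.
apply: latin_square_of_inj => [i j j'|j i i'] /(congr1 val) /= E;
  apply: val_inj; move: E; rewrite !M_entry;
  move: i j => [[|[|[|[|[|]]]]] // ?] [[|[|[|[|[|]]]]] // ?].
all: by [move: j' => [[|[|[|[|[|]]]]]] | move: i' => [[|[|[|[|[|]]]]]]].
Qed.

(* Rows 1 and 2 give h = u_1^-1 u_2 both h^2 = 1 (the intercalate in columns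
   1, 2) and h^3 = 1 (the 3-cycle in columns 3, 4, 5), so that h = 1. *)
Lemma M_not_group_array (gT : finGroupType) (u v w : 'I_5 -> gT) :
  (forall i j, (u i * v j)%g = w (M i j)) -> ~ injective u.
Proof.
move=> uv inju.
pose o k := inord k : 'I_5.
have step a b : M (o 0) (o a) = M (o 1%N) (o b) ->
    ((u (o 0))^-1 * u (o 1%N))%g = (v (o a) * (v (o b))^-1)%g.
  move=> E; apply: (mulgI (u (o 0))); apply: (mulIg (v (o b))).
  by rewrite mulKVg !mulgA mulgKV !uv E.
set h := (_^-1 * _)%g in step.
have Mo a b : nat_of_ord (M (o 0) (o a)) = M (o 1%N) (o b) ->
    h = (v (o a) * (v (o b))^-1)%g.
  by move=> E; apply: step; apply: val_inj.
have e01 : h = (v (o 0) * (v (o 1%N))^-1)%g by apply: Mo; rewrite ?M_entry ?inordK.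
have e10 : h = (v (o 1%N) * (v (o 0))^-1)%g by apply: Mo; rewrite ?M_entry ?inordK.
have e24 : h = (v (o 2) * (v (o 4))^-1)%g by apply: Mo; rewrite ?M_entry ?inordK.
have e43 : h = (v (o 4) * (v (o 3))^-1)%g by apply: Mo; rewrite ?M_entry ?inordK.
have e32 : h = (v (o 3) * (v (o 2))^-1)%g by apply: Mo; rewrite ?M_entry ?inordK.
have h2 : (h * h = 1)%g by rewrite {1}e01 e10 mulgA mulgKV mulgV.
have h3 : (h * h * h = 1)%g.
  by rewrite {1}e24 {1}e43 e32 !mulgA !mulgKV mulgV.
have h1 : h = 1%g by rewrite -h3 h2 mul1g.
have /inju/(congr1 val) : u (o 1%N) = u (o 0).
  by apply: (mulgI (u (o 0))^-1%g); rewrite mulVg.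
by rewrite /= !inordK.
Qed.

(** Composing the relabelling with the isotopy and with [g] gives a group array indexed like [M].
    The order [d] is left free because [realizes_group] quantifies over it. *)
Lemma not_isotopic_to_group_of_M d (L : 'M['I_d]_d) (t1 t2 t3 : 'I_5 -> 'I_d) :
  injective t1 -> (forall i j, L (t1 i) (t2 j) = t3 (M i j)) ->
  ~ isotopic_to_group L.
Proof.
move=> inj1 LM [gT [g [T [[/bij_inj injg gM] [r [c [s rcs]]]]]]].
apply: (@M_not_group_array gT (g \o r \o t1) (g \o c \o t2) (g \o s \o t3)).
  by move=> i j /=; rewrite -gM rcs LM.
by apply: inj_comp inj1; apply: inj_comp injg _; exact: perm_inj.
Qed.

Lemma M_not_isotopic_to_group : ~ isotopic_to_group M.
Proof. exact: (@not_isotopic_to_group_of_M 5 M id id id). Qed.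

(** * Lines as kernels of covectors; concurrency as a vanishing determinant *)

Section Concurrency.
Variable F : fieldType.
Local Open Scope ring_scope.
Implicit Types (l m : line F) (w v : 'rV[F]_3).

Definition has_equation l v := forall w, (w \in line_vs l) = (w *m v^T == 0).

Lemma line_of_equation v : v != 0 -> exists l, has_equation l v.
Proof.
move=> v0; pose f := linfun (mulmxr v^T : 'rV[F]_3 -> 'rV[F]_1).
have fE w : f w = w *m v^T by rewrite lfunE.
have f0 : f != 0.
  apply: contraNneq v0 => f0; apply/eqP/trmx_inj; rewrite trmx0.
  apply/row_matrixP => i; rewrite row0 rowE.
  by rewrite -fE f0 lfunE.
have dimf : \dim (limg f) = 1%N.
  apply/eqP; rewrite eqn_leq (leq_trans (dimvS (subvf _))) ?dimvf //=.
  rewrite lt0n dimv_eq0; apply: contraNneq f0 => im0.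
  apply/eqP/lfunP => w; rewrite zero_lfunE; apply/eqP.
  by rewrite -memv0 -im0 memv_img ?memvf.
have dimk : \dim (lker f) == 2.
  have := limg_ker_dim f fullv; rewrite capfv dimf dimvf addn1.
  by move/eqP; rewrite eqSS.
by exists (Line dimk) => w; rewrite memv_ker fE.
Qed.

Lemma concurrentP l1 l2 l3 : concurrent l1 l2 l3 <->
  exists2 w, w != 0 &
    [/\ w \in line_vs l1, w \in line_vs l2 & w \in line_vs l3].
Proof.
split=> [[p [p1 p2 p3]]|[w w0 [w1 w2 w3]]].
  have pw := memv_pick p; exists (vpick p).
    by rewrite vpick0 -dimv_eq0 (eqP (point_dim p)).
  by split; [exact: subvP p1 _ _ | exact: subvP p2 _ _ | exact: subvP p3 _ _].
have dw : \dim <[w]> == 1%N by rewrite dim_vline w0.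
by exists (Point dw); rewrite /on /= -!memvE.
Qed.

(** A common point is spanned by a nonzero vector killed by all three covectors, that is, by a
    nonzero kernel vector of the matrix they form. *)
Lemma concurrent_det l1 l2 l3 (v : 'I_3 -> 'rV[F]_3) :
  has_equation l1 (v 0) -> has_equation l2 (v 1) -> has_equation l3 (v 2) ->
  concurrent l1 l2 l3 <-> \det (\matrix_i v i) = 0.
Proof.
move=> e1 e2 e3.
have eA w : (w *m (\matrix_i v i)^T == 0) =
    [&& w *m (v 0)^T == 0, w *m (v 1)^T == 0 & w *m (v 2)^T == 0].
  have colE i : col i (w *m (\matrix_i v i)^T) = w *m (v i)^T.
    by rewrite colE -mulmxA -colE -tr_row rowK.
  apply/eqP/and3P => [wA|[/eqP w1 /eqP w2 /eqP w3]].
    by rewrite -!colE wA !col0.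
  apply/trmx_inj/row_matrixP => i; rewrite trmx0 row0 -tr_col colE.
  suff -> : w *m (v i)^T = 0 by rewrite trmx0.
  have : [|| i == 0, i == 1 | i == 2] by case: i => [[|[|[|]]]].
  by case/or3P => /eqP->.
apply: (iff_trans (concurrentP _ _ _)); rewrite -det_tr; split.
  case=> w w0 [w1 w2 w3]; apply/eqP/det0P; exists w => //; apply/eqP.
  by rewrite eA -e1 -e2 -e3 w1 w2 w3.
move/eqP/det0P => [w w0 /eqP]; rewrite eA -e1 -e2 -e3 => /and3P wl.
by exists w.
Qed.

(** Any two lines of a projective plane meet. This turns a coincidence of lines from two classes
    into a concurrence with every line of the remaining class. *)
Lemma concurrent_refl l m : concurrent l l m.
Proof.
have [->|/line_meet[p [[pl pm] _]]] := eqVneq l m; last by exists p.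
apply/concurrentP; exists (vpick m); last by rewrite memv_pick.
by rewrite vpick0 -dimv_eq0 (eqP (line_dim m)).
Qed.

End Concurrency.

(** * From concurrences prescribed by a Latin square to a 3-net *)

Section NetOfSquare.
Variables (F : fieldType) (d : nat).
Variables (l : 'I_3 -> 'I_d -> line F) (L : 'M['I_d]_d).
Hypotheses (d_gt1 : (1 < d)%N) (latL : latin_square L).
Hypothesis assL : associated_square l L.
Local Open Scope fset_scope.

Let k0 : 'I_3 := inord 0.
Let k1 : 'I_3 := inord 1.
Let k2 : 'I_3 := inord 2.

Lemma ord3_cases (i : 'I_3) : [\/ i = k0, i = k1 | i = k2].
Proof.
by case: i => [[|[|[|]]]] // hi; [apply: Or31 | apply: Or32 | apply: Or33];
  apply: val_inj; rewrite /= inordK.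
Qed.

Lemma latin_row_inj i : injective (L i).
Proof.
by move=> j j' E; have [x [_ u]] := latL.1 i (L i j); rewrite -(u j) // (u j').
Qed.

Lemma latin_col_inj j : injective (L^~ j).
Proof.
by move=> i i' E; have [x [_ u]] := latL.2 j (L i j); rewrite -(u i) // (u i').
Qed.

Lemma cross_point i j : exists p, [/\ on p (l k0 i), on p (l k1 j) & on p (l k2 (L i j))].
Proof. by apply/assL. Qed.

Lemma cross_eq p i j n :
  on p (l k0 i) -> on p (l k1 j) -> on p (l k2 n) -> L i j = n.
Proof. by move=> p0 p1 p2; apply/assL; exists p. Qed.

Lemma other_index (i : 'I_d) : exists j, j != i.
Proof.
have [a [b ab]] : exists a b : 'I_d, a != b.
  by exists (Ordinal (ltnW d_gt1)), (Ordinal d_gt1).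
by have [<-|ai] := eqVneq a i; [exists b; rewrite eq_sym | exists a].
Qed.

Lemma l0_neq_l1 i j : l k0 i != l k1 j.
Proof.
(* If the lines coincided, every symbol [n] would be the entry at [(i, j)]. *)
apply/eqP => E; have [n /eqP] := other_index (L i j); apply; symmetry.
by apply/assL; rewrite -/k0 -/k1 E; exact: concurrent_refl.
Qed.

Lemma l0_neq_l2 i n : l k0 i != l k2 n.
Proof.
apply/eqP => E.
(* A coincidence would make row [i] constant. *)
have c j : L i j = n.
  apply/assL; rewrite -/k0 -/k1 -/k2 E.
  by have [p [p2 _ p1]] := concurrent_refl (l k2 n) (l k1 j); exists p.
have [j /eqP] := other_index i; apply.
by apply: (@latin_row_inj i); rewrite !c.
Qed.

Lemma l1_neq_l2 j n : l k1 j != l k2 n.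
Proof.
apply/eqP => E.
(* A coincidence would make column [j] constant. *)
have c i : L i j = n.
  apply/assL; rewrite -/k0 -/k1 -/k2 E.
  by have [p [p2 _ p1]] := concurrent_refl (l k2 n) (l k0 i); exists p.
have [i /eqP] := other_index j; apply.
by apply: (@latin_col_inj j); rewrite !c.
Qed.

Lemma lines_neq i j a b : i != j -> l i a != l j b.
Proof.
case: (ord3_cases i) => ->; case: (ord3_cases j) => ->; rewrite ?eqxx // => _.
- exact: l0_neq_l1.
- exact: l0_neq_l2.
- by rewrite eq_sym; exact: l0_neq_l1.
- exact: l1_neq_l2.
- by rewrite eq_sym; exact: l0_neq_l2.
- by rewrite eq_sym; exact: l1_neq_l2.
Qed.

(** A crossing point on the line indexed [a] also lies on the equal line indexed [b], so one cell of
    the square can be read with either index. For the third class the cell is the one of row [a]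
    containing the symbol [a]. *)
Lemma lines_inj i : injective (l i).
Proof.
move=> a b; have [->|->|->] := ord3_cases i => E.
- have [p [p0 p1 p2]] := cross_point a a; rewrite E in p0.
  by apply: (@latin_col_inj a); rewrite (cross_eq p0 p1 p2).
- have [p [p0 p1 p2]] := cross_point a a; rewrite E in p1.
  by apply: (@latin_row_inj a); rewrite (cross_eq p0 p1 p2).
have [j [Lj _]] := latL.1 a a.
have [p [p0 p1 p2]] := cross_point a j; rewrite Lj E in p2.
by rewrite -Lj (cross_eq p0 p1 p2).
Qed.

Definition line_classes i : {fset line F} := [fset l i k | k in 'I_d].

Lemma line_classesP i m : reflect (exists k, m = l i k) (m \in line_classes i).
Proof.
by apply: (iffP (imfsetP _ _ _ _)) => [[k _ ->]|[k ->]]; exists k.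
Qed.

Lemma line_classes_labeling : is_labeling line_classes l.
Proof. by move=> i; split=> //; exact: lines_inj. Qed.

Lemma line_classes_degree : has_degree line_classes d.
Proof.
move=> i; rewrite card_imfset /=; last exact: lines_inj.
by rewrite -cardE card_ord.
Qed.

(** Two of row, column and symbol determine a cell of the Latin square. The three lines of that cell
    meet in a point, which must be [p] because distinct lines share only one point. *)
Lemma third_line (i j : 'I_3) p a b : i != j -> on p (l i a) -> on p (l j b) ->
  exists a' b', [/\ on p (l k0 a'), on p (l k1 b') & on p (l k2 (L a' b'))].
Proof.
have meet_eq (q : point F) (m m' : line F) : m != m' -> on p m -> on p m' ->
    on q m -> on q m' -> p = q.
  by move=> /line_meet[x [_ u]] pm pm' qm qm'; rewrite -(u p) // (u q).
have H01 a' b' : on p (l k0 a') -> on p (l k1 b') ->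
    exists a' b', [/\ on p (l k0 a'), on p (l k1 b') & on p (l k2 (L a' b'))].
  move=> p0 p1; exists a', b'; have [q [q0 q1 q2]] := cross_point a' b'.
  by rewrite (meet_eq q _ _ (l0_neq_l1 a' b')).
have H02 a' n : on p (l k0 a') -> on p (l k2 n) ->
    exists a' b', [/\ on p (l k0 a'), on p (l k1 b') & on p (l k2 (L a' b'))].
  move=> p0 p2; have [b' [Lb _]] := latL.1 a' n.
  exists a', b'; have [q [q0 q1 q2]] := cross_point a' b'; rewrite Lb in q2 *.
  by rewrite (meet_eq q _ _ (l0_neq_l2 a' n)).
have H12 b' n : on p (l k1 b') -> on p (l k2 n) ->
    exists a' b', [/\ on p (l k0 a'), on p (l k1 b') & on p (l k2 (L a' b'))].
  move=> p1 p2; have [a' [La _]] := latL.2 b' n.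
  exists a', b'; have [q [q0 q1 q2]] := cross_point a' b'; rewrite La in q2 *.
  by rewrite (meet_eq q _ _ (l1_neq_l2 b' n)).
case: (ord3_cases i) => ->; case: (ord3_cases j) => ->; rewrite ?eqxx // => _ pa pb.
all: by [exact: H01 pa pb | exact: H01 pb pa | exact: H02 pa pb
       | exact: H02 pb pa | exact: H12 pa pb | exact: H12 pb pa].
Qed.

Theorem net_of_latin_square : exists X, is_net3 line_classes X.
Proof.
have [P PE] : exists P : 'I_d * 'I_d -> point F, forall ij,
    [/\ on (P ij) (l k0 ij.1), on (P ij) (l k1 ij.2)
      & on (P ij) (l k2 (L ij.1 ij.2))].
  apply: (@fin_all_exists _ (fun=> point F) (fun ij p => [/\ on p (l k0 ij.1),
    on p (l k1 ij.2) & on p (l k2 (L ij.1 ij.2))])) => ij.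
  exact: cross_point.
exists [fset P ij | ij in {: 'I_d * 'I_d}]; split.
- by move=> i; rewrite -cardfs_gt0 line_classes_degree ltnW.
- move=> i j ij; apply/fdisjointP => m /line_classesP[a ->].
  by apply/negP => /line_classesP[b] E; have := lines_neq a b ij; rewrite E eqxx.
- move=> i j ij _ _ /line_classesP[a ->] /line_classesP[b ->] p pa pb.
  have [a' [b' [p0 p1 _]]] := third_line ij pa pb.
  apply/imfsetP; exists (a', b') => //=.
  have [q0 q1 _] := PE (a', b').
  by have [x [_ u]] := line_meet (l0_neq_l1 a' b'); rewrite -(u p) // (u (P (a', b'))).
move=> _ /imfsetP[[a b] _ ->] i; have /= [p0 p1 p2] := PE (a, b).
have uniq_line k : on (P (a, b)) (l i k) ->
    exists! m, m \in line_classes i /\ on (P (a, b)) m.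
  move=> pk; exists (l i k); split=> [|_ [/line_classesP[k' ->] pk']].
    by split=> //; apply/line_classesP; exists k.
  (* The lines of the other two classes through the point fix the remaining index: a row by column
     and symbol, a column by row and symbol, a symbol by its cell. *)
  congr (l i _); case: (ord3_cases i) pk pk' => -> pk pk'.
  - apply: (@latin_col_inj b).
    by rewrite (cross_eq pk p1 p2) (cross_eq pk' p1 p2).
  - apply: (@latin_row_inj a).
    by rewrite (cross_eq p0 pk p2) (cross_eq p0 pk' p2).
  by rewrite -(cross_eq p0 p1 pk) (cross_eq p0 p1 pk').
by case: (ord3_cases i) uniq_line => -> U; [apply: U p0 | apply: U p1 | apply: U p2].
Qed.

End NetOfSquare.

(** Both labelings enumerate the same classes, so each line named by [l] has a name under [l'], and
    concurrence does not depend on names. *)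
Lemma associated_square_relabel F (A : 'I_3 -> {fset line F}) d d'
    (l : 'I_3 -> 'I_d -> line F) (l' : 'I_3 -> 'I_d' -> line F)
    (L : 'M['I_d]_d) (L' : 'M['I_d']_d') :
  is_labeling A l -> is_labeling A l' ->
  associated_square l L -> associated_square l' L' ->
  exists t1 t2 t3 : 'I_d -> 'I_d', injective t1 /\
    forall i j, L' (t1 i) (t2 j) = t3 (L i j).
Proof.
move=> Al Al' lL lL'.
have relabel c : exists t, forall k, l' c (t k) = l c k.
  apply: (@fin_all_exists _ (fun=> 'I_d') (fun k k' => l' c k' = l c k)) => k.
  have [_ Ac] := Al c; have [_ Ac'] := Al' c.
  have : l c k \in A c by rewrite Ac; apply/imfsetP; exists k.
  by rewrite Ac' => /imfsetP[k' _ ->]; exists k'.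
have [t1 E1] := relabel (inord 0); have [t2 E2] := relabel (inord 1).
have [t3 E3] := relabel (inord 2).
exists t1, t2, t3; split=> [a b ab|i j].
  by apply: (proj1 (Al (inord 0))); rewrite -!E1 ab.
by apply/lL'; rewrite E1 E2 E3; exact/lL.
Qed.

(** * The explicit integer realization of [M] *)

Section Realization.

Local Open Scope ring_scope.

(* [net_coord c k] is the covector of the k-th line of class c. After fixing
   the first two lines of the first two classes, the realizations of M still
   form a family of positive dimension; this is an integral member of it. *)
Definition net_coord (c k j : nat) : int :=
  nth 0 (nth [::] (nth [::]
    [:: [:: [:: 0; 1; 0]; [:: 1; 0; 0]; [:: 3; 1; 2];
            [:: 1; -2; -5]; [:: 2; -1; 0]];
        [:: [:: 0; 0; 1]; [:: 1; 1; 1]; [:: 3; -2; -1];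
            [:: 1; 2; -1]; [:: 4; -1; 1]];
        [:: [:: 0; 1; 1]; [:: 1; 0; 1]; [:: 3; 1; -1];
            [:: 1; -2; -1]; [:: 4; -2; 1]]] c) k) j.

Lemma det3 (R : comRingType) (A : 'M[R]_3) : \det A =
  A 0 0 * (A 1 1 * A 2 2 - A 1 2 * A 2 1)
  - A 0 1 * (A 1 0 * A 2 2 - A 1 2 * A 2 0)
  + A 0 2 * (A 1 0 * A 2 1 - A 1 1 * A 2 0).
Proof.
(* Indexing by [nat] lets the lifted ordinals of the cofactor expansion reduce to numerals, so that
   [ring] recognizes equal entries. *)
have [a aE] : exists a : nat -> nat -> R, forall i j, A i j = a i j.
  by exists (fun i j => A (inord i) (inord j)) => i j; rewrite !inord_val.
rewrite (expand_det_row A 0) !big_ord_recl big_ord0 /cofactor.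
rewrite !(expand_det_row _ 0) !big_ord_recl !big_ord0 /cofactor !det_mx11 !mxE.
rewrite !aE /= /bump /=; ring.
Qed.

(** The expansion of [det3] on integer data, in a form that evaluates by computation. *)
Definition net_det (i j n : nat) : int :=
  let a := net_coord 0 i in let b := net_coord 1 j in let c := net_coord 2 n in
  a 0%N * (b 1%N * c 2%N - b 2%N * c 1%N)
  - a 1%N * (b 0%N * c 2%N - b 2%N * c 0%N)
  + a 2%N * (b 0%N * c 1%N - b 1%N * c 0%N).

Lemma net_detP (i j n : 'I_5) : (net_det i j n == 0) = (M i j == n).
Proof.
have -> : (M i j == n) = (M i j == n :> nat) by [].
rewrite M_entry.
by move: i j n => [[|[|[|[|[|]]]]] // ?] [[|[|[|[|[|]]]]] // ?] [[|[|[|[|[|]]]]] // ?].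
Qed.

(** In characteristic zero an integer determinant vanishes in [F] exactly when it vanishes as an
    integer, so [net_detP] decides every concurrence. *)
Lemma M_realized (F : numFieldType) :
  exists l : 'I_3 -> 'I_5 -> line F, associated_square l M.
Proof.
pose v (c : 'I_3) (k : 'I_5) : 'rV[F]_3 := \row_j (net_coord c k j)%:~R.
have v0 c k : v c k != 0.
  apply/eqP => /rowP v0.
  have z (j : 'I_3) : net_coord c k j = 0.
    by apply/eqP; rewrite -(intr_eq0 F); have := v0 j; rewrite !mxE => ->.
  move: (z 0) (z 1) (z 2) => {v0 z}.
  by case: c k => [[|[|[|]]] // ?] [[|[|[|[|[|]]]]] // ?].
have [l lP] : exists l : 'I_3 -> 'I_5 -> line F, forall c k, has_equation (l c k) (v c k).
  apply: (@fin_all_exists _ (fun=> 'I_5 -> line F)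
    (fun c lc => forall k, has_equation (lc k) (v c k))) => c.
  apply: (@fin_all_exists _ (fun=> line F)
    (fun k lk => has_equation lk (v c k))) => k.
  exact: line_of_equation.
exists l => i j n.
pose u (c : 'I_3) := if c == 0 then v (inord 0) i
  else if c == 1 then v (inord 1) j else v (inord 2) n.
have cdet := @concurrent_det F _ _ _ u (lP _ i) (lP _ j) (lP _ n).
have detE : \det (\matrix_i u i) = (net_det i j n)%:~R.
  rewrite det3 !mxE /= !inordK // !modn_small //=.
  by rewrite /net_det /= !(rmorphD, rmorphN, rmorphM).
have det0 : (\det (\matrix_i u i) == 0) = (M i j == n).
  by rewrite detE intr_eq0 net_detP.
apply: iff_sym; apply: (iff_trans cdet).
by split=> /eqP; [rewrite det0 | rewrite -det0] => /eqP.
Qed.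

End Realization.

Theorem mainTheorem1 (R : realType) :
  (exists (A : 'I_3 -> {fset line R[i]}) (X : {fset point R[i]}),
      [/\ is_net3 A X, has_degree A 5 & ~ realizes_group A]) /\
  [/\ latin_square M,
      ~ isotopic_to_group M
    & exists (A : 'I_3 -> {fset line R[i]}) (X : {fset point R[i]})
             (l : 'I_3 -> 'I_5 -> line R[i]),
        [/\ is_net3 A X, has_degree A 5, is_labeling A l
          & associated_square l M]].
Proof.
have [l lM] := M_realized R[i].
have [X netX] := @net_of_latin_square _ 5 l M isT M_latin lM.
have deg := line_classes_degree M_latin lM.
have lab := line_classes_labeling M_latin lM.
split; last first.
  split; [exact: M_latin | exact: M_not_isotopic_to_group |].
  by exists (line_classes l), X, l.
(* A labeling realizing a group may be any labeling of these classes; comparing it with [l] carries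
   [M] into its square. *)
exists (line_classes l), X; split=> // -[d [l' [L [lab' lL]]]].
have [t1 [t2 [t3 [inj1 LM]]]] := associated_square_relabel lab lab' lM lL.
exact: not_isotopic_to_group_of_M inj1 LM.
Qed.
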